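(* Let $\rho$ be any positive integer. Every integer $n$ with $n\ge 550\rho^2$ is a sum of at most four squares of integers in $S_\rho$, i.e. there exist $k\le 4$ and $x_1,\dots,x_k\in S_\rho$ with $n=x_1^2+\cdots+x_k^2$.
   Context: For a positive integer $\rho$, $S_\rho=\{n\in\mathbb{Z} : n\ge 0,\ n\neq\rho\}$. *)

(* Defs.v *)
From mathcomp Require Import all_boot all_order all_algebra.

Set Implicit Arguments.
Unset Strict Implicit.
Unset Printing Implicit Defensive.

Import Order.TTheory GRing.Theory Num.Theory.

Local Open Scope ring_scope.

Definition S_ (rho : int) : {pred int} :=
  [pred n : int | (0 <= n) && (n != rho)].

(* Main.v *)
Require Import Defs.
From mathcomp Require Import all_boot all_order all_algebra.
From mathcomp Require Import zify ring.

Import Order.TTheory GRing.Theory Num.Theory.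

Local Open Scope ring_scope.

(* By Lagrange, n = x1^2 + x2^2 + x3^2 + x4^2.  If three coordinates have, after
   sign changes, a sum 3s divisible by 3, then subtracting 2s from each of them
   (the reflection in the plane orthogonal to (1, 1, 1)) gives another
   representation.  Suppose every representation of n has a coordinate of
   absolute value rho, and start from (rho, b, c, d).  Each available reflection
   of a triple containing rho then yields a linear relation between rho and two
   of b, c, d with few possible shapes, and a short case analysis on the
   residues mod 3 gives enough independent relations to make b, c, d multiples
   of rho so small that n < 550 rho^2.  If 3 divides b, c, d but not rho, one
   first reflects (b, c, d) until no coordinate is divisible by 3; if 3 divides
   all of rho, b, c, d, one divides by 3 and descends on rho. *)

Definition sum4 (n a b c d : int) : Prop :=
  n = a ^+ 2 + b ^+ 2 + c ^+ 2 + d ^+ 2.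

Ltac sum4_ring := etransitivity; [eassumption | ring].

(** * Lagrange's four-square theorem *)

(** Euler's identity (the quaternion norm is multiplicative). One factor is conjugated, so that
    quadruples congruent modulo [m], with norms divisible by [m], give entries divisible by [m]. *)
Lemma sum4_mul (m n a b c d x y z w : int) :
  sum4 m a b c d -> sum4 n x y z w ->
  sum4 (m * n) (a * x + b * y + c * z + d * w) (a * y - b * x + c * w - d * z)
    (a * z - b * w - c * x + d * y) (a * w + b * z - c * y - d * x).
Proof. by rewrite /sum4 => -> ->; ring. Qed.

Lemma centered_residue (m x : int) :
  0 < m -> exists y k : int, x = y + m * k /\ - m <= 2 * y <= m.
Proof.
move=> m_gt0; have := divz_eq x m; have := modz_ge0 x (lt0r_neq0 m_gt0).
have := ltz_pmod x m_gt0; move: (x %% m)%Z (x %/ m)%Z => r q r_lt r_ge ->.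
have [le_r|lt_r] := leP (2 * r) m.
  by exists r, q; split; [ring | lia].
by exists (r - m), (q + 1); split; [ring | lia].
Qed.

Lemma sqr_centered (m y : int) : - m <= 2 * y <= m -> 4 * y ^+ 2 <= m ^+ 2.
Proof.
move=> y_le; have /andP[m_y m'y] : (0 <= m - 2 * y) && (0 <= m + 2 * y) by lia.
rewrite -subr_ge0; have -> : m ^+ 2 - 4 * y ^+ 2 = (m - 2 * y) * (m + 2 * y) by ring.
exact: mulr_ge0.
Qed.

Lemma sum4_eq0 (a b c d : int) :
  sum4 0 a b c d -> [/\ a = 0, b = 0, c = 0 & d = 0].
Proof.
move/esym/eqP; rewrite !paddr_eq0 ?addr_ge0 ?sqr_ge0 // !sqrf_eq0.
by case/andP=> /andP[/andP[/eqP-> /eqP->] /eqP->] /eqP->.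
Qed.

(** Lagrange's descent: for [m > 1], the squares of the centred residues modulo [m] sum to [m * r]
    with [r <= m]. Both [r = 0] and [r = m] would make [m] divide [p]; otherwise Euler's identity
    divided by [m ^+ 2] represents [r * p]. *)
Lemma sum4_descent (p m a b c d : int) :
  (forall k : int, 1 < k < p -> ~~ (k %| p)%Z) ->
  0 < m < p -> sum4 (m * p) a b c d ->
  exists x y z w, sum4 p x y z w.
Proof.
move=> p_pr; have [k le_k] := ubnP (absz m).
elim: k => // k IH in m a b c d le_k * => /andP[m_gt0 m_lt] mp_eq.
have [m1|m_neq1] := eqVneq m 1.
  by exists a, b, c, d; rewrite m1 mul1r in mp_eq.
have {m_neq1} /p_pr m_ndvd : 1 < m < p by lia.
have m_neq0 : m != 0 by rewrite gt_eqF.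
have [y1 [k1 [aE y1_le]]] := centered_residue m a m_gt0.
have [y2 [k2 [bE y2_le]]] := centered_residue m b m_gt0.
have [y3 [k3 [cE y3_le]]] := centered_residue m c m_gt0.
have [y4 [k4 [dE y4_le]]] := centered_residue m d m_gt0.
rewrite {a}aE {b}bE {c}cE {d}dE in mp_eq.
pose r := p - (2 * (y1 * k1 + y2 * k2 + y3 * k3 + y4 * k4) +
  m * (k1 ^+ 2 + k2 ^+ 2 + k3 ^+ 2 + k4 ^+ 2)).
have rE : sum4 (m * r) y1 y2 y3 y4.
  by rewrite /sum4 /r mulrBr mp_eq; ring.
have r_ge0 : 0 <= r.
  by rewrite -(pmulr_rge0 _ m_gt0) rE !addr_ge0 ?sqr_ge0.
have r_le : r <= m.
  rewrite -(ler_pM2l m_gt0) -(@ler_pM2l _ 4) // rE.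
  move: (sqr_centered _ _ y1_le) (sqr_centered _ _ y2_le)
    (sqr_centered _ _ y3_le) (sqr_centered _ _ y4_le).
  rewrite -expr2; move: (m ^+ 2) (y1 ^+ 2) (y2 ^+ 2) (y3 ^+ 2) (y4 ^+ 2).
  by clear; lia.
have [r0|r_neq0] := eqVneq r 0.
  have [y1_0 y2_0 y3_0 y4_0] : [/\ y1 = 0, y2 = 0, y3 = 0 & y4 = 0].
    by apply: sum4_eq0; rewrite -(mulr0 m) -r0.
  case/negP: m_ndvd; apply/dvdzP; exists (k1 ^+ 2 + k2 ^+ 2 + k3 ^+ 2 + k4 ^+ 2).
  by move: r0; rewrite /r y1_0 y2_0 y3_0 y4_0 => /subr0_eq ->; ring.
have [rm|r_neqm] := eqVneq r m.
  (* Each [2 y_i] is an odd multiple of [m], and a sum of four odd squares is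
     divisible by 4, so [m] divides [p]. *)
  have half (y : int) : 4 * y ^+ 2 = m ^+ 2 -> exists2 e, 2 * y = e * m & e ^+ 2 = 1.
    move=> yE; have /eqP : (2 * y) ^+ 2 = m ^+ 2 by rewrite exprMn yE.
    rewrite eqf_sqr => /orP[] /eqP ->; first by exists 1; rewrite ?mul1r.
    by exists (-1); rewrite ?mulN1r ?sqrrN.
  have [/half[e1 y1E e1E] /half[e2 y2E e2E] /half[e3 y3E e3E] /half[e4 y4E e4E]] :
      [/\ 4 * y1 ^+ 2 = m ^+ 2, 4 * y2 ^+ 2 = m ^+ 2, 4 * y3 ^+ 2 = m ^+ 2
        & 4 * y4 ^+ 2 = m ^+ 2].
    move: (sqr_centered _ _ y1_le) (sqr_centered _ _ y2_le)
      (sqr_centered _ _ y3_le) (sqr_centered _ _ y4_le).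
    move: rE; rewrite /sum4 rm -expr2.
    move: (m ^+ 2) (y1 ^+ 2) (y2 ^+ 2) (y3 ^+ 2) (y4 ^+ 2) => M Y1 Y2 Y3 Y4; clear.
    by move=> rE *; split; lia.
  case/negP: m_ndvd; apply/dvdzP.
  exists (1 + (k1 ^+ 2 + e1 * k1) + (k2 ^+ 2 + e2 * k2) + (k3 ^+ 2 + e3 * k3) +
    (k4 ^+ 2 + e4 * k4)).
  have /mulfI inj : 4 * m != 0 by rewrite mulf_neq0.
  apply: inj; transitivity (4 * (m * p)); first by ring.
  rewrite mp_eq.
  transitivity ((2 * y1 + 2 * (m * k1)) ^+ 2 + (2 * y2 + 2 * (m * k2)) ^+ 2 +
    (2 * y3 + 2 * (m * k3)) ^+ 2 + (2 * y4 + 2 * (m * k4)) ^+ 2); first by ring.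
  have term (e l : int) : e ^+ 2 = 1 ->
      (e * m + 2 * (m * l)) ^+ 2 = m ^+ 2 * (1 + 4 * (l ^+ 2 + e * l)).
    move=> e_sq; transitivity (m ^+ 2 * (e ^+ 2 + 4 * (l ^+ 2 + e * l))); first by ring.
    by rewrite e_sq.
  by rewrite y1E y2E y3E y4E !term //; ring.
have r_lt : (absz r < k)%N by lia.
(* These are the entries of [sum4_mul] divided by [m]: the products of residues add up to [m * r] in
   the first entry and cancel in the others. *)
apply: (IH r (r + (k1 * y1 + k2 * y2 + k3 * y3 + k4 * y4))
  (k1 * y2 - k2 * y1 + k3 * y4 - k4 * y3)
  (k1 * y3 - k2 * y4 - k3 * y1 + k4 * y2)
  (k1 * y4 + k2 * y3 - k3 * y2 - k4 * y1) r_lt); first by lia.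
have /mulfI inj : m ^+ 2 != 0 by rewrite expf_neq0.
apply: inj; have := sum4_mul _ _ _ _ _ _ _ _ _ _ mp_eq rE.
rewrite /sum4 => /esym mr; transitivity (m * p * (m * r)); first by ring.
rewrite -{}mr.
have -> : m ^+ 2 * ((r + (k1 * y1 + k2 * y2 + k3 * y3 + k4 * y4)) ^+ 2 +
 (k1 * y2 - k2 * y1 + k3 * y4 - k4 * y3) ^+ 2 +
 (k1 * y3 - k2 * y4 - k3 * y1 + k4 * y2) ^+ 2 +
 (k1 * y4 + k2 * y3 - k3 * y2 - k4 * y1) ^+ 2) =
 (m * r + m * (k1 * y1 + k2 * y2 + k3 * y3 + k4 * y4)) ^+ 2 +
 (m * (k1 * y2 - k2 * y1 + k3 * y4 - k4 * y3)) ^+ 2 +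
 (m * (k1 * y3 - k2 * y4 - k3 * y1 + k4 * y2)) ^+ 2 +
 (m * (k1 * y4 + k2 * y3 - k3 * y2 - k4 * y1)) ^+ 2 by ring.
by rewrite rE; ring.
Qed.

(** Pigeonhole in ['F_p]: with [p = 2 * h + 1], the [h + 1] distinct squares [i ^ 2] and the [h + 1]
    distinct values [- (j ^ 2 + 1)] must meet. *)
Lemma prime_dvd_sum2_add1 (p : nat) :
  prime p -> odd p -> exists i j : nat,
    [/\ (2 * i < p)%N, (2 * j < p)%N & (p %| i ^ 2 + j ^ 2 + 1)%N].
Proof.
move=> p_pr p_odd; have p_gt1 := prime_gt1 p_pr.
pose h := p./2; have pE : p = (2 * h + 1)%N by rewrite /h; lia.
have zeroE k : (p %| k)%N = (k%:R == 0 :> 'F_p) := dvdn_pcharf (pchar_Fp p_pr) k.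
pose f (u : 'I_h.+1 + 'I_h.+1) : 'F_p :=
  match u with inl i => i%:R ^+ 2 | inr j => - (j%:R ^+ 2 + 1) end.
have sq_inj (i j : 'I_h.+1) : i%:R ^+ 2 = j%:R ^+ 2 :> 'F_p -> i = j.
  wlog le_ij : i j / (i <= j)%N.
    by move=> W ij; case: (leqP i j) => [/W->//|/ltnW/W->//].
  move=> ij; apply/val_inj/eqP; rewrite eqn_leq le_ij /= leqNgt; apply/negP => lt_ij.
  have : (p %| (j - i) * (j + i))%N.
    by rewrite -subn_sqr zeroE natrB ?leq_sqr // !natrX ij subrr.
  rewrite Euclid_dvdM // => /orP[] /dvdn_leq; have := ltn_ord j; lia.
have /injectivePn[u [v uv fuv]] : ~~ injectiveb f.
  apply/negP => /injectiveP/leq_card; rewrite card_Fp // card_sum !card_ord.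
  by clear -pE; lia.
have found (i j : 'I_h.+1) : i%:R ^+ 2 = - (j%:R ^+ 2 + 1) :> 'F_p ->
    exists i j : nat, [/\ (2 * i < p)%N, (2 * j < p)%N & (p %| i ^ 2 + j ^ 2 + 1)%N].
  move=> ij; exists i, j; split; [have := ltn_ord i; lia | have := ltn_ord j; lia |].
  by rewrite zeroE !natrD !natrX ij -addrA addNr.
case: u v uv fuv => [i|i] [j|j] /= uv.
- by move/sq_inj => ij; rewrite ij eqxx in uv.
- exact: found.
- by move/esym; apply: found.
- by move/oppr_inj/addIr/sq_inj => ij; rewrite ij eqxx in uv.
Qed.

Lemma four_squares_prime (p : nat) : prime p -> exists x y z w, sum4 p%:Z x y z w.
Proof.
move=> p_pr; have [p2|p_odd] := even_prime p_pr; first by exists 1, 1, 0, 0; rewrite p2.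
have [i [j [i_lt j_lt /dvdnP[m mE]]]] := prime_dvd_sum2_add1 p p_pr p_odd.
apply: (sum4_descent p%:Z m%:Z i%:Z j%:Z 1 0).
- move=> k /andP[k_gt1 k_lt]; apply/negP; rewrite /dvdz => /(primeP p_pr).2; lia.
- have m_gt0 : (0 < m)%N by case: (m) mE => //; rewrite addn1.
  rewrite !ltz_nat m_gt0 /= -(ltn_pmul2r (prime_gt0 p_pr)) -mE.
  move: i_lt j_lt (prime_gt1 p_pr).
  rewrite -(ltn_sqr (2 * i)) -(ltn_sqr (2 * j)) -(ltn_sqr 1) !expnMn mulnn.
  by move: (i ^ 2)%N (j ^ 2)%N (p ^ 2)%N => I J P; clear; lia.
- by rewrite /sum4 -PoszM -mE -!mulnn !PoszD !PoszM; ring.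
Qed.

Lemma lagrange_four_squares (n : nat) : exists x y z w, sum4 n%:Z x y z w.
Proof.
elim/ltn_ind: n => n IH; have [n_le1|n_gt1] := leqP n 1.
  by exists n%:Z, 0, 0, 0; case: n n_le1 {IH} => [|[]].
have [x [y [z [w pE]]]] := four_squares_prime _ (pdiv_prime n_gt1).
have [|x' [y' [z' [w' qE]]]] := IH (n %/ pdiv n)%N.
  by rewrite ltn_Pdiv ?prime_gt1 ?pdiv_prime // ltnW.
have := sum4_mul _ _ _ _ _ _ _ _ _ _ pE qE; rewrite -PoszM mulnC divnK ?pdiv_dvd //.
by do 4!eexists; eassumption.
Qed.

(** * Reflections moving the coordinate [rho] *)

Lemma sqr_norm_eq (x y : int) : `|x| = y -> x ^+ 2 = y ^+ 2.
Proof. by rewrite -[x ^+ 2]real_normK ?num_real // => ->. Qed.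

(** A counterexample to the theorem, with signed coordinates so that reflections apply directly. *)
Definition exceptional (rho n : int) : Prop :=
  [/\ 0 < rho, 550 * rho ^+ 2 <= n
    & forall a b c d : int, sum4 n a b c d ->
      `|a| = rho \/ `|b| = rho \/ `|c| = rho \/ `|d| = rho].

Lemma sum4_reflect (n a b c d s : int) :
  a + b + c = 3 * s -> sum4 n a b c d ->
  sum4 n (a - 2 * s) (b - 2 * s) (c - 2 * s) d.
Proof.
move=> sE; have -> : c = 3 * s - a - b by lia.
by rewrite /sum4 => ->; ring.
Qed.

(* The six cases in which reflecting [(rho, b, c)] in the plane orthogonal to
   [(1, 1, 1)] produces a coordinate [rho] or [- rho]. *)
Definition stuck (rho b c : int) : Prop :=
  b + c = - rho \/ b + c = 2 * rho \/ b - 2 * c = 5 * rho \/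
  b - 2 * c = - rho \/ c - 2 * b = 5 * rho \/ c - 2 * b = - rho.

Lemma stuck_sym (rho b c : int) : stuck rho b c -> stuck rho c b.
Proof. rewrite /stuck; lia. Qed.

(** The reflected representation again contains [rho] up to sign, and not as [d], which stays in
    place. *)
Lemma exceptional_reflect (rho n b c d : int) :
  exceptional rho n -> sum4 n rho b c d -> (3 %| rho + b + c)%Z ->
  `|d| <> rho -> stuck rho b c.
Proof.
case=> rho_gt0 _ blk n_eq /dvdzP[s sE] d_rho.
have {}sE : rho + b + c = 3 * s by rewrite sE mulrC.
case: (blk _ _ _ _ (sum4_reflect _ _ _ _ _ _ sE n_eq)) => [h|[h|[h|//]]].
all: clear -sE h; rewrite /stuck; lia.
Qed.

(* [549 = 550 - 1]: the coordinate [rho] itself contributes 1. *)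
Lemma exceptional_box (beta gamma delta rho n b c d : int) :
  exceptional rho n -> sum4 n rho b c d ->
  beta ^+ 2 + gamma ^+ 2 + delta ^+ 2 < 549 ->
  - (beta * rho) <= b <= beta * rho ->
  - (gamma * rho) <= c <= gamma * rho ->
  - (delta * rho) <= d <= delta * rho -> False.
Proof.
case=> rho_gt0 n_ge _; rewrite /sum4 => defn small.
rewrite -!ler_norml => leb lec led.
have sq (k x : int) : `|x| <= k * rho -> x ^+ 2 <= k ^+ 2 * rho ^+ 2.
  rewrite -exprMn -[x ^+ 2]real_normK ?num_real // => le.
  by rewrite lerXn2r ?nnegrE //; apply: le_trans le.
move: (sq _ _ leb) (sq _ _ lec) (sq _ _ led) => {sq leb}sqb {lec}sqc {led}sqd.
have rho2_gt0 : 0 < rho ^+ 2 by rewrite exprn_gt0.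
have : (beta ^+ 2 + gamma ^+ 2 + delta ^+ 2) * rho ^+ 2 <= 548 * rho ^+ 2.
  by rewrite ler_wpM2r ?(ltW rho2_gt0) // -ltzD1.
suff : n <= rho ^+ 2 + (beta ^+ 2 + gamma ^+ 2 + delta ^+ 2) * rho ^+ 2.
  by lia.
by rewrite defn !mulrDl !addrA !lerD.
Qed.

(** The bounds are made for [exceptional_box]: [3 * 13 ^ 2 = 507] and [17 ^ 2 + 2 * 11 ^ 2 = 531]
    are below 549. *)
Lemma stuck_triangle (rho b c d : int) :
  0 < rho -> stuck rho b c -> stuck rho b d -> stuck rho c d ->
  - (17 * rho) <= b <= 13 * rho /\
  (b < - (13 * rho) ->
   - (11 * rho) <= c <= 11 * rho /\ - (11 * rho) <= d <= 11 * rho).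
Proof.
rewrite /stuck => rho_gt0 bc bd cd; split; first by lia.
by move=> lt_b; split; lia.
Qed.

(** * Representations with no coordinate divisible by 3 *)

(** As the coordinates agree modulo 3, every triple containing [rho] can be reflected, so all pairs
    from [b], [c], [d] are stuck. *)
Lemma congruent_units_avoiding (rho n b c d : int) :
  exceptional rho n -> sum4 n rho b c d ->
  (3 %| rho - b)%Z -> (3 %| rho - c)%Z -> (3 %| rho - d)%Z ->
  `|b| <> rho -> `|c| <> rho -> `|d| <> rho -> False.
Proof.
move=> exc n_eq b3 c3 d3 b_rho c_rho d_rho.
have [rho_gt0 _ _] := exc.
have bc3 : (3 %| rho + b + c)%Z by clear -b3 c3; lia.
have bd3 : (3 %| rho + b + d)%Z by clear -b3 d3; lia.
have cd3 : (3 %| rho + c + d)%Z by clear -c3 d3; lia.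
have m1 := exceptional_reflect _ _ _ _ _ exc n_eq bc3 d_rho.
have m2 := exceptional_reflect rho n b d c exc ltac:(sum4_ring) bd3 c_rho.
have m3 := exceptional_reflect rho n c d b exc ltac:(sum4_ring) cd3 b_rho.
clear b_rho c_rho d_rho b3 c3 d3 bc3 bd3 cd3.
have [b_box b_lt] := stuck_triangle _ _ _ _ rho_gt0 m1 m2 m3.
have [c_box c_lt] := stuck_triangle _ _ _ _ rho_gt0 (stuck_sym _ _ _ m1) m3 m2.
have [d_box d_lt] := stuck_triangle _ _ _ _ rho_gt0
  (stuck_sym _ _ _ m2) (stuck_sym _ _ _ m3) m1.
clear m1 m2 m3.
have [{}/b_lt[? ?]|b_ge] := ltP b (- (13 * rho)).
  by apply: (exceptional_box 17 11 11 _ _ _ _ _ exc n_eq) => //; lia.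
have [{}/c_lt[? ?]|c_ge] := ltP c (- (13 * rho)).
  by apply: (exceptional_box 11 17 11 _ _ _ _ _ exc n_eq) => //; lia.
have [{}/d_lt[? ?]|d_ge] := ltP d (- (13 * rho)).
  by apply: (exceptional_box 11 11 17 _ _ _ _ _ exc n_eq) => //; lia.
by apply: (exceptional_box 13 13 13 _ _ _ _ _ exc n_eq) => //; lia.
Qed.

Lemma mod3_flip (x y : int) :
  ~~ (3 %| x)%Z -> ~~ (3 %| y)%Z ->
  exists2 z, z = y \/ z = - y & (3 %| x - z)%Z.
Proof.
move=> x3 y3; have [xy|xy] : (3 %| x - y)%Z \/ (3 %| x - - y)%Z by lia.
- by exists y => //; left.
- by exists (- y) => //; right.
Qed.

Lemma units_avoiding (rho n b c d : int) :
  exceptional rho n -> sum4 n rho b c d ->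
  ~~ (3 %| rho)%Z -> ~~ (3 %| b)%Z -> ~~ (3 %| c)%Z -> ~~ (3 %| d)%Z ->
  `|b| <> rho -> `|c| <> rho -> `|d| <> rho -> False.
Proof.
move=> exc n_eq rho3 b3 c3 d3 b_rho c_rho d_rho.
have [b' bE b'3] := mod3_flip _ _ rho3 b3.
have [c' cE c'3] := mod3_flip _ _ rho3 c3.
have [d' dE d'3] := mod3_flip _ _ rho3 d3.
apply: (congruent_units_avoiding _ _ b' c' d' exc _ b'3 c'3 d'3).
- by case: bE => ->; case: cE => ->; case: dE => ->; sum4_ring.
- by case: bE => ->; rewrite ?normrN.
- by case: cE => ->; rewrite ?normrN.
- by case: dE => ->; rewrite ?normrN.
Qed.

(* The representations substituted below arise from [(rho, rho, rho, c)] by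
   reflecting [(rho, rho, c)] and then, if needed, the three coordinates that
   have become divisible by 3. *)
Lemma units_three_rho (rho n c : int) :
  exceptional rho n -> sum4 n rho rho rho c ->
  ~~ (3 %| rho)%Z -> (3 %| rho - c)%Z -> False.
Proof.
move=> exc n_eq rho3 /dvdzP[t tE].
have [rho_gt0 _ _] := exc.
have cE : c = rho + 3 * - t by lia.
move: (- t) cE => {tE}t cE.
(* Outside this range no new coordinate below is [rho] up to sign; the extreme coincidence is
   [r = rho], where [c = 13 * rho]. *)
have big : - (13 * rho) <= c <= 13 * rho -> False.
  by apply: (exceptional_box 1 1 13 _ _ _ _ _ exc n_eq) => //; lia.
rewrite {}cE in n_eq big.
have [t3|/dvdzP[r rE]] : ~~ (3 %| t - rho)%Z \/ (3 %| t - rho)%Z by lia.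
  have n_eq1 : sum4 n rho (rho + 2 * t) (rho + 2 * t) (t - rho) by sum4_ring.
  by apply: units_avoiding exc n_eq1 _ _ _ _ _ _ _ => //; lia.
have {rE} tE : t = rho + 3 * r by lia.
rewrite {}tE in n_eq big.
have [r3|r3] : ~~ (3 %| r)%Z \/ (3 %| r)%Z by lia.
  have n_eq1 : sum4 n rho (3 * rho + 4 * r) (3 * rho + 8 * r) r by sum4_ring.
  by apply: units_avoiding exc n_eq1 _ _ _ _ _ _ _ => //; lia.
have n_eq1 : sum4 n rho (rho + 4 * r) (rho + 4 * r) (4 * rho + 7 * r) by sum4_ring.
by apply: units_avoiding exc n_eq1 _ _ _ _ _ _ _ => //; lia.
Qed.

(** Reflecting [rho], [rho], [b'] keeps [c'], which is not [rho] by the case split and not [- rho]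
    by its residue. Hence [b'], and likewise [c'], is one of [rho], [- 2 * rho], [7 * rho]. *)
Lemma units_two_rho (rho n b c : int) :
  exceptional rho n -> sum4 n rho rho b c ->
  ~~ (3 %| rho)%Z -> ~~ (3 %| b)%Z -> ~~ (3 %| c)%Z -> False.
Proof.
move=> exc n_eq rho3 b3 c3.
have [rho_gt0 _ _] := exc.
have {b3} [b' bE b3] := mod3_flip _ _ rho3 b3.
have {c3} [c' cE c3] := mod3_flip _ _ rho3 c3.
have {}n_eq : sum4 n rho rho b' c' by case: bE => ->; case: cE => ->; sum4_ring.
have n_eq' : sum4 n rho rho c' b' by sum4_ring.
have [b_rho|b_rho] := eqVneq b' rho.
  by rewrite b_rho in n_eq; apply: units_three_rho exc n_eq rho3 c3.
have [c_rho|c_rho] := eqVneq c' rho.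
  by rewrite c_rho in n_eq'; apply: units_three_rho exc n_eq' rho3 b3.
have stb : stuck rho rho b'.
  by apply: exceptional_reflect exc n_eq _ _; clear -rho_gt0 rho3 b3 c3 c_rho; lia.
have stc : stuck rho rho c'.
  by apply: exceptional_reflect exc n_eq' _ _; clear -rho_gt0 rho3 b3 c3 b_rho; lia.
rewrite /stuck in stb stc.
by apply: (exceptional_box 1 7 7 _ _ _ _ _ exc n_eq) => //; clear -stb stc rho_gt0; lia.
Qed.

Lemma units (rho n b c d : int) :
  exceptional rho n -> sum4 n rho b c d ->
  ~~ (3 %| rho)%Z -> ~~ (3 %| b)%Z -> ~~ (3 %| c)%Z -> ~~ (3 %| d)%Z -> False.
Proof.
move=> exc n_eq rho3 b3 c3 d3.
have [/sqr_norm_eq bE|/eqP b_rho] := eqVneq `|b| rho.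
  apply: (units_two_rho _ _ c d exc) => //.
  by rewrite /sum4 n_eq bE.
have [/sqr_norm_eq cE|/eqP c_rho] := eqVneq `|c| rho.
  apply: (units_two_rho _ _ b d exc) => //.
  by rewrite /sum4 n_eq cE; ring.
have [/sqr_norm_eq dE|/eqP d_rho] := eqVneq `|d| rho.
  apply: (units_two_rho _ _ b c exc) => //.
  by rewrite /sum4 n_eq dE; ring.
exact: units_avoiding exc n_eq _ _ _ _ _ _ _.
Qed.

(** * Representations where 3 divides some coordinate but not [rho] *)

(** Divide by 3 until some coordinate is not a multiple of 3, then choose signs so that 3 does not
    divide [s = x' + e * y' + f * z']. Three times this signed triple has sum [3 * s], and its
    reflection has all entries congruent to [s] modulo 3. *)
Lemma sum3_units (b c d : int) :
  (3 %| b)%Z -> (3 %| c)%Z -> (3 %| d)%Z ->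
  b ^+ 2 + c ^+ 2 + d ^+ 2 != 0 ->
  exists b' c' d' : int,
    [/\ ~~ (3 %| b')%Z, ~~ (3 %| c')%Z, ~~ (3 %| d')%Z
      & b ^+ 2 + c ^+ 2 + d ^+ 2 = b' ^+ 2 + c' ^+ 2 + d' ^+ 2].
Proof.
have [k le_k] := ubnP (absz (b ^+ 2 + c ^+ 2 + d ^+ 2)).
elim: k => // k IH in b c d le_k *.
move=> /dvdzP[x xE] /dvdzP[y yE] /dvdzP[z zE]; rewrite {b}xE {c}yE {d}zE in le_k * => nz.
have [x' [y' [z' [nz3 xyzE]]]] : exists x' y' z' : int,
    ~~ [&& (3 %| x')%Z, (3 %| y')%Z & (3 %| z')%Z] /\
    x ^+ 2 + y ^+ 2 + z ^+ 2 = x' ^+ 2 + y' ^+ 2 + z' ^+ 2.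
  have [/and3P[x3 y3 z3]|] := boolP [&& (3 %| x)%Z, (3 %| y)%Z & (3 %| z)%Z];
    last by exists x, y, z.
  have [||x' [y' [z' [x'3 _ _ xyzE]]]] := IH x y z _ x3 y3 z3.
  - move: nz le_k; rewrite !exprMn -!mulrDl.
    have : 0 <= x ^+ 2 + y ^+ 2 + z ^+ 2 by rewrite !addr_ge0 ?sqr_ge0.
    by move: (_ + _) => m; clear; lia.
  - by apply: contra nz; rewrite !exprMn -!mulrDl => /eqP ->.
  by exists x', y', z'; rewrite negb_and x'3.
have {xyzE} -> : (x * 3) ^+ 2 + (y * 3) ^+ 2 + (z * 3) ^+ 2 =
    9 * (x' ^+ 2 + y' ^+ 2 + z' ^+ 2) by rewrite -xyzE; ring.
have [e [f [ef3 esq fsq]]] : exists e f : int,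
    [/\ ~~ (3 %| x' + e * y' + f * z')%Z, e ^+ 2 = 1 & f ^+ 2 = 1].
  have [h|[h|[h|h]]] : ~~ (3 %| x' + y' + z')%Z \/ ~~ (3 %| x' - y' + z')%Z \/
    ~~ (3 %| x' + y' - z')%Z \/ ~~ (3 %| x' - y' - z')%Z by clear -nz3; lia.
  - by exists 1, 1; rewrite !mul1r.
  - by exists (-1), 1; rewrite mulN1r mul1r.
  - by exists 1, (-1); rewrite mulN1r mul1r.
  - by exists (-1), (-1); rewrite !mulN1r.
set s := x' + e * y' + f * z' in ef3.
exists (3 * x' - 2 * s), (3 * (e * y') - 2 * s), (3 * (f * z') - 2 * s).
have yE : y' ^+ 2 = (e * y') ^+ 2 by rewrite exprMn esq mul1r.
have zE : z' ^+ 2 = (f * z') ^+ 2 by rewrite exprMn fsq mul1r.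
rewrite yE zE; have defs : s = x' + e * y' + f * z' by [].
move: (e * y') (f * z') s ef3 defs => y1 z1 s s3 sE; split.
- by clear -s3; lia.
- by clear -s3; lia.
- by clear -s3; lia.
- by rewrite sE; ring.
Qed.

Lemma no_unit (rho n b c d : int) :
  exceptional rho n -> sum4 n rho b c d ->
  ~~ (3 %| rho)%Z -> (3 %| b)%Z -> (3 %| c)%Z -> (3 %| d)%Z -> False.
Proof.
move=> exc n_eq rho3 b3 c3 d3.
have [eq0|nz] := eqVneq (b ^+ 2 + c ^+ 2 + d ^+ 2) 0.
  have [rho_gt0 n_ge _] := exc; have := exprn_gt0 2 rho_gt0.
  move: n_ge; rewrite n_eq -!addrA (addrA (b ^+ 2)) eq0.
  by move: (rho ^+ 2) => r2; clear; lia.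
have [b' [c' [d' [b'3 c'3 d'3 bcdE]]]] := sum3_units _ _ _ b3 c3 d3 nz.
apply: units exc _ rho3 b'3 c'3 d'3.
by rewrite /sum4 n_eq -!addrA (addrA (b ^+ 2)) bcdE !addrA.
Qed.

(** Serves coordinates [c] divisible by 3, for which both signs can be used in a reflection. *)
Lemma stuck_opp (rho b c : int) :
  0 < rho -> stuck rho b c -> stuck rho b (- c) ->
  - (9 * rho) <= b <= 9 * rho /\ - (9 * rho) <= c <= 9 * rho.
Proof. by rewrite /stuck => rho_gt0 st st'; split; lia. Qed.

(** The reflected triples consist of [rho], [- b'] and either sign of [c] or of [d]; the coordinate
    left over is a multiple of 3, hence not [rho] up to sign. *)
Lemma one_unit (rho n b c d : int) :
  exceptional rho n -> sum4 n rho b c d ->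
  ~~ (3 %| rho)%Z -> ~~ (3 %| b)%Z -> (3 %| c)%Z -> (3 %| d)%Z -> False.
Proof.
move=> exc n_eq rho3 /(mod3_flip _ _ rho3)[b' bE b3] c3 d3.
have [rho_gt0 _ _] := exc.
have {bE} n_eq1 : sum4 n rho (- b') c d by case: bE => ->; sum4_ring.
have c_rho : `|c| <> rho by clear -rho3 c3; lia.
have d_rho : `|d| <> rho by clear -rho3 d3; lia.
have Nc_rho : `|- c| <> rho by rewrite normrN.
have Nd_rho : `|- d| <> rho by rewrite normrN.
have [||b_le c_le] := stuck_opp rho (- b') c rho_gt0.
- by apply: exceptional_reflect exc n_eq1 _ d_rho; clear -b3 c3; lia.
- apply: (exceptional_reflect _ n _ _ d exc _ _ d_rho); first by sum4_ring.
  by clear -b3 c3; lia.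
have [||_ d_le] := stuck_opp rho (- b') d rho_gt0.
- apply: (exceptional_reflect _ n _ _ c exc _ _ c_rho); first by sum4_ring.
  by clear -b3 d3; lia.
- apply: (exceptional_reflect _ n _ _ c exc _ _ c_rho); first by sum4_ring.
  by clear -b3 d3; lia.
exact: (exceptional_box 9 9 9 _ _ _ _ _ exc n_eq1).
Qed.

Lemma two_units_avoiding (rho n b c d : int) :
  exceptional rho n -> sum4 n rho b c d ->
  ~~ (3 %| rho)%Z -> ~~ (3 %| b)%Z -> ~~ (3 %| c)%Z -> (3 %| d)%Z ->
  `|b| <> rho -> `|c| <> rho -> False.
Proof.
move=> exc n_eq rho3 b3 c3 d3 b_rho c_rho.
have [rho_gt0 _ _] := exc.
have {b3} [b' bE b3] := mod3_flip _ _ rho3 b3.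
have {c3} [c' cE c3] := mod3_flip _ _ rho3 c3.
have {b_rho} b_rho : `|- b'| <> rho by case: bE => ->; rewrite ?opprK ?normrN.
have {c_rho} c_rho : `|- c'| <> rho by case: cE => ->; rewrite ?opprK ?normrN.
have {bE cE} n_eq1 : sum4 n rho (- b') (- c') d.
  by case: bE => ->; case: cE => ->; sum4_ring.
have [||b_le d_le] := stuck_opp rho (- b') d rho_gt0.
- apply: (exceptional_reflect _ n _ _ (- c') exc _ _ c_rho); first by sum4_ring.
  by clear -b3 d3; lia.
- apply: (exceptional_reflect _ n _ _ (- c') exc _ _ c_rho); first by sum4_ring.
  by clear -b3 d3; lia.
have [||c_le _] := stuck_opp rho (- c') d rho_gt0.
- apply: (exceptional_reflect _ n _ _ (- b') exc _ _ b_rho); first by sum4_ring.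
  by clear -c3 d3; lia.
- apply: (exceptional_reflect _ n _ _ (- b') exc _ _ b_rho); first by sum4_ring.
  by clear -c3 d3; lia.
exact: (exceptional_box 9 9 9 _ _ _ _ _ exc n_eq1).
Qed.

(* The representations passed to [zero] are the images of [(rho, rho, b, d)]
   under the reflection of the triple made of one [rho], [b] and [d]. *)
Lemma two_units_rho (rho n b d : int) :
  exceptional rho n -> sum4 n rho rho b d ->
  ~~ (3 %| rho)%Z -> ~~ (3 %| b)%Z -> (3 %| d)%Z -> False.
Proof.
move=> exc n_eq rho3 /(mod3_flip _ _ rho3)[b' bE b3] d3.
have [rho_gt0 _ _] := exc.
have {b bE} n_eq : sum4 n rho rho b' d by case: bE => ->; sum4_ring.
have stb : stuck rho rho b'.
  apply: exceptional_reflect exc n_eq _ _; first by clear -b3; lia.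
  by clear -rho3 d3; lia.
have {stb} bE : b' = rho \/ b' = - 2 * rho \/ b' = 7 * rho.
  by move: stb; rewrite /stuck; clear; lia.
(* In this range the box applies, as [1 + 7 ^ 2 + 21 ^ 2 = 491]. A larger [d] keeps the first two
   coordinates passed to [zero] away from [rho] and [- rho]. *)
have d_big : - (21 * rho) <= d <= 21 * rho -> False.
  by apply: (exceptional_box 1 7 21 _ _ _ _ _ exc n_eq) => //; clear -bE rho_gt0; lia.
have /dvdzP[t tE] := d3; have {}tE : d = 3 * t by rewrite tE mulrC.
have zero x y z : sum4 n rho x y z -> ~~ (3 %| x)%Z -> ~~ (3 %| y)%Z -> (3 %| z)%Z ->
  `|x| <> rho -> `|y| <> rho -> False.
  by move=> n_eq1 x3 y3 z3; apply: two_units_avoiding exc n_eq1 rho3 x3 y3 z3.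
rewrite {d}tE in n_eq d3 d_big.
(* The residue of [t] decides which new coordinate is the multiple of 3, to be passed last. *)
have [t3|[t3|t3]] : (3 %| t)%Z \/ (3 %| t - rho)%Z \/ (3 %| t + rho)%Z.
  by clear -rho3; lia.
all: case: bE n_eq => [->|[->|->]] n_eq.
- apply: (zero (2 * t - rho) (2 * t + rho) t); 
    [by sum4_ring | by clear -rho_gt0 rho3 t3 d_big; lia ..].
- apply: (zero (rho + 2 * t) (t - 2 * rho) (2 * t)); 
    [by sum4_ring | by clear -rho_gt0 rho3 t3 d_big; lia ..].
- apply: (zero (5 * rho - 2 * t) (4 * rho + t) (3 * rho + 2 * t)); 
    [by sum4_ring | by clear -rho_gt0 rho3 t3 d_big; lia ..].
- apply: (zero (2 * t - rho) t (2 * t + rho)); 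
    [by sum4_ring | by clear -rho_gt0 rho3 t3 d_big; lia ..].
- apply: (zero (2 * t) (t - 2 * rho) (rho + 2 * t)); 
    [by sum4_ring | by clear -rho_gt0 rho3 t3 d_big; lia ..].
- apply: (zero (3 * rho + 2 * t) (4 * rho + t) (5 * rho - 2 * t)); 
    [by sum4_ring | by clear -rho_gt0 rho3 t3 d_big; lia ..].
- apply: (zero (2 * t + rho) t (2 * t - rho)); 
    [by sum4_ring | by clear -rho_gt0 rho3 t3 d_big; lia ..].
- apply: (zero (2 * t) (rho + 2 * t) (t - 2 * rho)); 
    [by sum4_ring | by clear -rho_gt0 rho3 t3 d_big; lia ..].
- apply: (zero (3 * rho + 2 * t) (5 * rho - 2 * t) (4 * rho + t)); 
    [by sum4_ring | by clear -rho_gt0 rho3 t3 d_big; lia ..].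
Qed.

Lemma two_units (rho n b c d : int) :
  exceptional rho n -> sum4 n rho b c d ->
  ~~ (3 %| rho)%Z -> ~~ (3 %| b)%Z -> ~~ (3 %| c)%Z -> (3 %| d)%Z -> False.
Proof.
move=> exc n_eq rho3 b3 c3 d3.
have [/sqr_norm_eq bE|/eqP b_rho] := eqVneq `|b| rho.
  apply: (two_units_rho _ _ c d exc) => //.
  by rewrite /sum4 n_eq bE.
have [/sqr_norm_eq cE|/eqP c_rho] := eqVneq `|c| rho.
  apply: (two_units_rho _ _ b d exc) => //.
  by rewrite /sum4 n_eq cE; ring.
exact: two_units_avoiding exc n_eq rho3 b3 c3 d3 b_rho c_rho.
Qed.

(** * Representations where 3 divides [rho] but not every coordinate *)

(** When 3 divides [rho] and [b + c], the pair can be reflected with [rho] both as it stands and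
    negated. *)
Lemma stuck_neg (rho b c : int) :
  0 < rho -> stuck rho b c -> stuck rho (- b) (- c) ->
  - (4 * rho) <= b <= 4 * rho /\ - (4 * rho) <= c <= 4 * rho.
Proof. by rewrite /stuck => rho_gt0 st st'; split; lia. Qed.

Lemma mult_two_units_le (rho n b c d : int) :
  exceptional rho n -> sum4 n rho b c d ->
  (3 %| rho)%Z -> (3 %| b + c)%Z -> `|d| <> rho ->
  - (4 * rho) <= b <= 4 * rho /\ - (4 * rho) <= c <= 4 * rho.
Proof.
move=> exc n_eq rho3 bc3 d_rho; have [rho_gt0 _ _] := exc.
apply: stuck_neg => //.
- by apply: exceptional_reflect exc n_eq _ d_rho; clear -rho3 bc3; lia.
- apply: (exceptional_reflect _ n _ _ d exc _ _ d_rho); first by sum4_ring.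
  by clear -rho3 bc3; lia.
Qed.

Lemma mult_three_units (rho n b c d : int) :
  exceptional rho n -> sum4 n rho b c d ->
  (3 %| rho)%Z -> ~~ (3 %| b)%Z -> ~~ (3 %| c)%Z -> ~~ (3 %| d)%Z -> False.
Proof.
move=> exc n_eq rho3 b3 c3 d3; have [rho_gt0 _ _] := exc.
have {c3} [c' cE c3] := mod3_flip _ _ b3 c3.
have {c cE} n_eq : sum4 n rho b (- c') d by case: cE => ->; sum4_ring.
have c_rho : `|- c'| <> rho by clear -rho3 b3 c3; lia.
have d_rho : `|d| <> rho by clear -rho3 d3; lia.
have bc3 : (3 %| b + - c')%Z by clear -c3; lia.
have [b_le c_le] := mult_two_units_le _ _ _ _ _ exc n_eq rho3 bc3 d_rho.
have {d3} [d' dE d3] := mod3_flip _ _ b3 d3.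
have {}n_eq : sum4 n rho b (- d') (- c') by case: dE => ->; sum4_ring.
have bd3 : (3 %| b + - d')%Z by clear -d3; lia.
have [_ d_le] := mult_two_units_le _ _ _ _ _ exc n_eq rho3 bd3 c_rho.
exact: (exceptional_box 4 4 4 _ _ _ _ _ exc n_eq).
Qed.

(** Since [b] and [c] are at most [4 * rho] in size, the box forces [d] beyond [22 * rho].
    Reflecting [b], [c], [d] moves [b] and [c] beyond [5 * rho] and keeps [d] beyond [rho]; two new
    coordinates with sum divisible by 3 then contradict [mult_two_units_le]. *)
Lemma mult_two_units_avoiding (rho n b c d : int) :
  exceptional rho n -> sum4 n rho b c d ->
  (3 %| rho)%Z -> ~~ (3 %| b)%Z -> (3 %| b + c)%Z -> (3 %| d)%Z ->
  `|d| <> rho -> False.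
Proof.
move=> exc n_eq rho3 b3 bc3 d3 d_rho; have [rho_gt0 _ _] := exc.
have [b_le c_le] := mult_two_units_le _ _ _ _ _ exc n_eq rho3 bc3 d_rho.
have d_big : - (22 * rho) <= d <= 22 * rho -> False.
  exact: (exceptional_box 4 4 22 _ _ _ _ _ exc n_eq).
have [s sE] : exists s, b + c + d = 3 * s.
  by exists ((b + c + d) %/ 3)%Z; clear -bc3 d3; lia.
have {}n_eq : sum4 n rho (b - 2 * s) (c - 2 * s) (d - 2 * s).
  have n_eq1 : sum4 n b c d rho by sum4_ring.
  by have n_eq2 := sum4_reflect _ _ _ _ _ _ sE n_eq1; sum4_ring.
have [s3|[s3|s3]] : (3 %| s)%Z \/ (3 %| b - s)%Z \/ (3 %| b + s)%Z by clear -b3; lia.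
- have [||b'_le _] := mult_two_units_le _ _ _ _ _ exc n_eq rho3.
  + by clear -s3 bc3; lia.
  + by clear -sE b_le c_le d_big rho_gt0; lia.
  by clear -sE b_le c_le b'_le d_big rho_gt0; lia.
- have n_eq1 : sum4 n rho (b - 2 * s) (d - 2 * s) (c - 2 * s) by sum4_ring.
  have [||b'_le _] := mult_two_units_le _ _ _ _ _ exc n_eq1 rho3.
  + by clear -s3 d3; lia.
  + by clear -sE b_le c_le d_big rho_gt0; lia.
  by clear -sE b_le c_le b'_le d_big rho_gt0; lia.
- have n_eq1 : sum4 n rho (c - 2 * s) (d - 2 * s) (b - 2 * s) by sum4_ring.
  have [||b'_le _] := mult_two_units_le _ _ _ _ _ exc n_eq1 rho3.
  + by clear -s3 d3 bc3; lia.
  + by clear -sE b_le c_le d_big rho_gt0; lia.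
  by clear -sE b_le c_le b'_le d_big rho_gt0; lia.
Qed.

(** If not stuck, reflecting one [rho] with [b] and [c] leaves the other [rho] as the only one up to
    sign, which [mult_two_units_avoiding] excludes. *)
Lemma mult_two_units_rho_stuck (rho n b c : int) :
  exceptional rho n -> sum4 n rho rho b c ->
  (3 %| rho)%Z -> ~~ (3 %| b)%Z -> (3 %| b + c)%Z -> stuck rho b c.
Proof.
move=> exc n_eq rho3 b3 bc3.
have [//|not_stuck] : stuck rho b c \/ ~ stuck rho b c by rewrite /stuck; lia.
have [s sE] : exists s, rho + b + c = 3 * s.
  by exists ((rho + b + c) %/ 3)%Z; clear -bc3 rho3; lia.
have {}n_eq : sum4 n rho (rho - 2 * s) (b - 2 * s) (c - 2 * s).
  have n_eq1 : sum4 n rho b c rho by sum4_ring.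
  by have n_eq2 := sum4_reflect _ _ _ _ _ _ sE n_eq1; sum4_ring.
have r_rho : `|rho - 2 * s| <> rho.
  by move=> h; apply: not_stuck; rewrite /stuck; clear -h sE; lia.
have b_rho : `|b - 2 * s| <> rho.
  by move=> h; apply: not_stuck; rewrite /stuck; clear -h sE; lia.
have c_rho : `|c - 2 * s| <> rho.
  by move=> h; apply: not_stuck; rewrite /stuck; clear -h sE; lia.
exfalso.
have [s3|[s3|s3]] : (3 %| s)%Z \/ (3 %| b - s)%Z \/ (3 %| b + s)%Z by clear -b3; lia.
- apply: (mult_two_units_avoiding _ n (b - 2 * s) (c - 2 * s) _ exc _ rho3 _ _ _ r_rho);
    [by sum4_ring | by clear -rho3 s3 b3 bc3; lia ..].
- apply: (mult_two_units_avoiding _ n (b - 2 * s) (rho - 2 * s) _ exc _ rho3 _ _ _ c_rho);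
    [by sum4_ring | by clear -rho3 s3 b3 bc3; lia ..].
- apply: (mult_two_units_avoiding _ n (c - 2 * s) (rho - 2 * s) _ exc _ rho3 _ _ _ b_rho);
    [by sum4_ring | by clear -rho3 s3 b3 bc3; lia ..].
Qed.

Lemma mult_two_units (rho n b c d : int) :
  exceptional rho n -> sum4 n rho b c d ->
  (3 %| rho)%Z -> ~~ (3 %| b)%Z -> ~~ (3 %| c)%Z -> (3 %| d)%Z -> False.
Proof.
move=> exc n_eq rho3 b3 c3 d3; have [rho_gt0 _ _] := exc.
have {c3} [c' cE c3] := mod3_flip _ _ b3 c3.
have {c cE} n_eq : sum4 n rho b (- c') d by case: cE => ->; sum4_ring.
have bc3 : (3 %| b + - c')%Z by clear -c3; lia.
have [d_rho|/eqP d_rho] := eqVneq `|d| rho; last first.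
  exact: mult_two_units_avoiding exc n_eq rho3 b3 bc3 d3 d_rho.
have {d_rho d3} n_eq1 : sum4 n rho rho b (- c').
  by rewrite /sum4 n_eq -[d ^+ 2]real_normK ?num_real // d_rho; ring.
have n_eq2 : sum4 n rho rho (- b) (- - c') by sum4_ring.
have [|b_le c_le] := stuck_neg _ _ _ rho_gt0
  (mult_two_units_rho_stuck _ _ _ _ exc n_eq1 rho3 b3 bc3).
  by apply: mult_two_units_rho_stuck exc n_eq2 rho3 _ _; clear -b3 bc3; lia.
apply: (exceptional_box 1 4 4 _ _ _ _ _ exc n_eq1) => //.
by clear -rho_gt0; lia.
Qed.

(** All four sign patterns of [c] and [d] are stuck, which is inconsistent for positive [rho]. *)
Lemma mult_one_unit (rho n b c d : int) :
  exceptional rho n -> sum4 n rho b c d ->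
  (3 %| rho)%Z -> ~~ (3 %| b)%Z -> (3 %| c)%Z -> (3 %| d)%Z -> False.
Proof.
move=> exc n_eq rho3 b3 c3 d3; have [rho_gt0 _ _] := exc.
have b_rho : `|b| <> rho by clear -rho3 b3; lia.
have st (x y : int) : sum4 n rho x y b -> (3 %| x)%Z -> (3 %| y)%Z -> stuck rho x y.
  move=> n_eq1 x3 y3; apply: exceptional_reflect exc n_eq1 _ b_rho.
  by clear -rho3 x3 y3; lia.
have st1 : stuck rho c d by apply: st => //; sum4_ring.
have st2 : stuck rho c (- d) by apply: st; [sum4_ring | | clear -d3; lia].
have st3 : stuck rho (- c) d by apply: st; [sum4_ring | clear -c3; lia | ].
have st4 : stuck rho (- c) (- d).
  by apply: st; [sum4_ring | clear -c3; lia | clear -d3; lia].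
by move: st1 st2 st3 st4; rewrite /stuck; clear -rho_gt0; lia.
Qed.

(** * Descent on [rho] and conclusion *)

(** The fifteen other divisibility patterns are, up to permuting [b], [c], [d], the cases excluded
    above. *)
Lemma exceptional_not_rep (rho n b c d : int) :
  exceptional rho n -> sum4 n rho b c d ->
  [&& (3 %| rho)%Z, (3 %| b)%Z, (3 %| c)%Z & (3 %| d)%Z].
Proof.
move=> exc n_eq.
have bdc : sum4 n rho b d c by sum4_ring.
have cbd : sum4 n rho c b d by sum4_ring.
have cdb : sum4 n rho c d b by sum4_ring.
have dbc : sum4 n rho d b c by sum4_ring.
have [rho3|rho3] := boolP (3 %| rho)%Z;
  have [b3|b3] := boolP (3 %| b)%Z;
  have [c3|c3] := boolP (3 %| c)%Z;
  have [d3|d3] := boolP (3 %| d)%Z => //; exfalso.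
all: eauto using units, no_unit, one_unit, two_units, mult_three_units,
  mult_two_units, mult_one_unit.
Qed.

(** With all coordinates divisible by 3, [rho / 3] and [n / 9] are again exceptional: the bound
    scales by 9, and tripling turns representations of [n / 9] into ones of [n]. *)
Lemma not_exceptional (rho n : int) : ~ exceptional rho n.
Proof.
have [k] := ubnP (absz rho); elim: k => // k IH in rho n * => le_k exc.
have [rho_gt0 n_ge blk] := exc.
have n_ge0 : 0 <= n by apply: le_trans n_ge; rewrite mulr_ge0 ?sqr_ge0.
have [b [c [d n_eq]]] : exists b c d, sum4 n rho b c d.
  have [x [y [z [w n_eq]]]] := lagrange_four_squares (absz n).
  rewrite gez0_abs // in n_eq.
  case: (blk _ _ _ _ n_eq) => [|[|[|]]] /sqr_norm_eq uE.
  - by exists y, z, w; rewrite /sum4 n_eq uE.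
  - by exists x, z, w; rewrite /sum4 n_eq uE; ring.
  - by exists x, y, w; rewrite /sum4 n_eq uE; ring.
  - by exists x, y, z; rewrite /sum4 n_eq uE; ring.
have /and4P[/dvdzP[rho' rhoE] /dvdzP[b' bE] /dvdzP[c' cE] /dvdzP[d' dE]] :=
  exceptional_not_rep _ _ _ _ _ exc n_eq.
pose n' := rho' ^+ 2 + b' ^+ 2 + c' ^+ 2 + d' ^+ 2.
have nE : n = 9 * n' by rewrite n_eq rhoE bE cE dE /n'; ring.
have rho'_lt : (absz rho' < k)%N by clear -rhoE le_k rho_gt0; lia.
apply: (IH rho' n' rho'_lt); split; first by clear -rhoE rho_gt0; lia.
  move: n_ge; rewrite nE rhoE exprMn; move: (rho' ^+ 2) => r2; clear; lia.
move=> x y z w n'_eq.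
have := blk (3 * x) (3 * y) (3 * z) (3 * w); rewrite rhoE.
rewrite !normrM ![_ * 3]mulrC ger0_norm // => blk'.
have /blk' : sum4 n (3 * x) (3 * y) (3 * z) (3 * w).
  by rewrite nE n'_eq; rewrite /sum4; ring.
by have inj (u : int) : 3 * u = 3 * rho' -> u = rho' by [apply: mulfI];
  case=> [/inj|[/inj|[/inj|/inj]]]; tauto.
Qed.

Theorem theorem2p1 (rho : int) (rho_gt0 : 0 < rho)
    (n : int) (n_ge : 550 * rho ^+ 2 <= n) :
  exists (k : nat) (x : 'I_k -> int),
    [/\ (k <= 4)%N,
        forall i : 'I_k, x i \in S_ rho
      & n = \sum_(i < k) x i ^+ 2].
Proof.
have n_ge0 : 0 <= n by apply: le_trans n_ge; rewrite mulr_ge0 ?sqr_ge0.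
(* A coordinate with [x ^+ 2 <= n] has absolute value at most [n], so a finite search decides
   whether a good representation exists. *)
pose N := (absz n).+1.
have [/existsP[a /existsP[b /existsP[c /existsP[d]]]]|none] := boolP [exists a : 'I_N,
    exists b : 'I_N, exists c : 'I_N, exists d : 'I_N,
    (n == (a : nat)%:Z ^+ 2 + b%:Z ^+ 2 + c%:Z ^+ 2 + d%:Z ^+ 2) &&
    (rho \notin [:: a%:Z; b%:Z; c%:Z; d%:Z])].
  case/andP=> /eqP nE; rewrite !inE !negb_or => /and4P[a_rho b_rho c_rho d_rho].
  exists 4, (fun i : 'I_4 => nth 0 [:: a%:Z; b%:Z; c%:Z; d%:Z] i); split=> //.
    by case=> [[|[|[|[|]]]]] //= _; rewrite inE eq_sym ?a_rho ?b_rho ?c_rho ?d_rho.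
  by rewrite !big_ord_recl big_ord0 /= addr0 nE !addrA.
case: (not_exceptional rho n); split=> // a b c d n_eq.
have bound (x : int) : x ^+ 2 <= n -> (absz x < N)%N.
  move=> x_le; rewrite ltnS; apply: (@leq_trans (absz (x ^+ 2))).
    by rewrite abszX -mulnn; case: (absz x) => // m; rewrite leq_pmulr.
  by have := sqr_ge0 x; move: (x ^+ 2) x_le => y; clear; lia.
have [|/eqP a_rho] := eqVneq `|a| rho; first by left.
have [|/eqP b_rho] := eqVneq `|b| rho; first by right; left.
have [|/eqP c_rho] := eqVneq `|c| rho; first by right; right; left.
have [|/eqP d_rho] := eqVneq `|d| rho; first by right; right; right.
(* The absolute values of [a], [b], [c], [d] would have been found by the search. *)
case/negP: none.
have lt_a : (absz a < N)%N by apply: bound; rewrite n_eq -!addrA lerDl !addr_ge0 ?sqr_ge0.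
have lt_b : (absz b < N)%N.
  by apply: bound; rewrite n_eq (addrC (a ^+ 2)) -!addrA lerDl !addr_ge0 ?sqr_ge0.
have lt_c : (absz c < N)%N.
  by apply: bound; rewrite n_eq (addrC _ (c ^+ 2)) -!addrA lerDl !addr_ge0 ?sqr_ge0.
have lt_d : (absz d < N)%N by apply: bound; rewrite n_eq lerDr !addr_ge0 ?sqr_ge0.
apply/existsP; exists (Ordinal lt_a); apply/existsP; exists (Ordinal lt_b).
apply/existsP; exists (Ordinal lt_c); apply/existsP; exists (Ordinal lt_d).
rewrite /= !abszE !real_normK ?num_real // -n_eq eqxx /= !inE !negb_or ![rho == _]eq_sym.
by apply/and4P; split; apply/eqP.
Qed.
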